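(* Let $(x,X)\in\mathrm{QPB}_3$. Then there exists $z\in\mathbb{R}$ such that $(x,X,z)$ satisfies all of the following: (i) the linear constraints $$z\ge 0,\quad z\le X_{12},\quad z\le X_{13},\quad z\le X_{23},$$ $$X_{12}+X_{13}\le x_1+z,\quad X_{12}+X_{23}\le x_2+z,\quad X_{13}+X_{23}\le x_3+z,$$ $$x_1+x_2+x_3+z\le X_{12}+X_{13}+X_{23}+1;$$ (ii) the constraints $z^2\le X_{11}X_{23}$, $z^2\le X_{22}X_{13}$, $z^2\le X_{33}X_{12}$ and all constraints obtained from them by switching the variables in any subset $S\subseteq\{1,2,3\}$; (iii) for every permutation $(i,j,k)$ of $(1,2,3)$, the constraint $(X_{ij}+z)^2\le X_{ii}(X_{jj}+3X_{jk})$ and all constraints obtained from it by switching the variables in any subset $S\subseteq\{1,2,3\}$.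
   Context: Let $\mathrm{Box}_3=\{x\in\mathbb{R}^3 : 0\le x_i\le 1,\ i=1,2,3\}$. For $x\in\mathbb{R}^3$ and a symmetric $3\times 3$ matrix $X$ let $Y(x,X)=\begin{pmatrix}1 & x^T\\ x & X\end{pmatrix}$. Let $\mathrm{QPB}_3$ be the convex hull of $\{(1,x^T)^T(1,x^T) : x\in\mathrm{Box}_3\}$; $(x,X)\in\mathrm{QPB}_3$ means $Y(x,X)\in\mathrm{QPB}_3$. The variable $z$ is a proxy for the product $x_1x_2x_3$. The constraints in (ii) and (iii) are rotated second-order cone constraints: a constraint $u^2\le vw$ of this kind is understood to include $v\ge 0$ and $w\ge 0$. Switching the variables in a set $S\subseteq\{1,2,3\}$ in a constraint in $(x,X,z)$ means making simultaneously the following substitutions: $x_p\mapsto 1-x_p$ for $p\in S$ and $x_p\mapsto x_p$ for $p\notin S$; $X_{pp}\mapsto 1-2x_p+X_{pp}$ for $p\in S$ and $X_{pp}\mapsto X_{pp}$ for $p\notin S$; for $p\ne q$: $X_{pq}\mapsto X_{pq}$ if $p,q\notin S$, $X_{pq}\mapsto x_q-X_{pq}$ if $p\in S$, $q\notin S$, and $X_{pq}\mapsto X_{pq}+1-x_p-x_q$ if $p,q\in S$; and $z\mapsto z$ if $S=\emptyset$, $z\mapsto X_{qr}-z$ if $S=\{p\}$ with $\{p,q,r\}=\{1,2,3\}$, $z\mapsto x_r-X_{pr}-X_{qr}+z$ if $S=\{p,q\}$ with $\{p,q,r\}=\{1,2,3\}$, and $z\mapsto 1-x_1-x_2-x_3+X_{12}+X_{13}+X_{23}-z$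 if $S=\{1,2,3\}$. *)

(* Defs.v *)
From mathcomp Require Export all_boot all_order all_algebra all_fingroup.
From mathcomp Require Export classical_sets reals.

Set Implicit Arguments.
Unset Strict Implicit.
Unset Printing Implicit Defensive.

Import Order.TTheory GRing.Theory Num.Theory.

Local Open Scope classical_set_scope.
Local Open Scope ring_scope.

(* The mathematical indices 1, 2, 3. *)
Definition i1 : 'I_3 := @Ordinal 3 0 isT.
Definition i2 : 'I_3 := @Ordinal 3 1 isT.
Definition i3 : 'I_3 := @Ordinal 3 2 isT.

Definition convex_hull (R : realType) (E : lmodType R) (A : set E) : set E :=
  [set y | exists (n : nat) (c : 'I_n -> R) (a : 'I_n -> E),
    [/\ forall i, 0 <= c i, \sum_i c i = 1, forall i, A (a i)
      & y = \sum_i c i *: a i]].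

Definition Box3 (R : realType) : set 'cV[R]_3 :=
  [set x | forall i, 0 <= x i 0 <= 1].

Definition Ymx (R : realType) (x : 'cV[R]_3) (X : 'M[R]_3) : 'M[R]_(1 + 3) :=
  block_mx 1%:M x^T x X.

(* The row vector (1, x^T). *)
Definition hom_row (R : realType) (x : 'cV[R]_3) : 'rV[R]_(1 + 3) :=
  row_mx 1%:M x^T.

Definition QPB3 (R : realType) : set 'M[R]_(1 + 3) :=
  convex_hull [set (hom_row x)^T *m hom_row x | x in @Box3 R].

(* Rotated second-order cone constraint u^2 <= v w. *)
Definition rsoc (R : realType) (u v w : R) : Prop :=
  [/\ u ^+ 2 <= v * w, 0 <= v & 0 <= w].

Definition constraint (R : realType) := 'cV[R]_3 -> 'M[R]_3 -> R -> Prop.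

Definition switch_x (R : realType) (S : {set 'I_3}) (x : 'cV[R]_3) :
    'cV[R]_3 :=
  \col_p (if p \in S then 1 - x p 0 else x p 0).

Definition switch_X (R : realType) (S : {set 'I_3}) (x : 'cV[R]_3)
    (X : 'M[R]_3) : 'M[R]_3 :=
  \matrix_(p, q)
    if p == q then
      if p \in S then 1 - 2 * x p 0 + X p p else X p p
    else
      match p \in S, q \in S with
      | false, false => X p q
      | true, false => x q 0 - X p q
      | false, true => x p 0 - X p q
      | true, true => X p q + 1 - x p 0 - x q 0
      end.

Definition switch_z (R : realType) (S : {set 'I_3}) (x : 'cV[R]_3)
    (X : 'M[R]_3) (z : R) : R :=
  match i1 \in S, i2 \in S, i3 \in S with
  | false, false, false => z
  | true, false, false => X i2 i3 - z
  | false, true, false => X i1 i3 - z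
  | false, false, true => X i1 i2 - z
  | true, true, false => x i3 0 - X i1 i3 - X i2 i3 + z
  | true, false, true => x i2 0 - X i1 i2 - X i2 i3 + z
  | false, true, true => x i1 0 - X i1 i2 - X i1 i3 + z
  | true, true, true =>
      1 - x i1 0 - x i2 0 - x i3 0 + X i1 i2 + X i1 i3 + X i2 i3 - z
  end.

(* Simultaneous substitution: every component is computed from the original
   (x, X, z).  For S = set0 the constraint is unchanged. *)
Definition switch (R : realType) (S : {set 'I_3}) (c : constraint R) :
    constraint R :=
  fun x X z => c (switch_x S x) (switch_X S x X) (switch_z S x X z).

Definition linear_constraints (R : realType) : constraint R := fun x X z =>
  [/\ [/\ 0 <= z, z <= X i1 i2, z <= X i1 i3 & z <= X i2 i3],
      X i1 i2 + X i1 i3 <= x i1 0 + z,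
      X i1 i2 + X i2 i3 <= x i2 0 + z,
      X i1 i3 + X i2 i3 <= x i3 0 + z
    & x i1 0 + x i2 0 + x i3 0 + z <= X i1 i2 + X i1 i3 + X i2 i3 + 1].

(* z^2 <= X_{ii} X_{jk} *)
Definition soc_z (R : realType) (i j k : 'I_3) : constraint R :=
  fun x X z => rsoc z (X i i) (X j k).

(* (X_{ij} + z)^2 <= X_{ii} (X_{jj} + 3 X_{jk}) *)
Definition soc_Xz (R : realType) (i j k : 'I_3) : constraint R :=
  fun x X z => rsoc (X i j + z) (X i i) (X j j + 3 * X j k).

(* Main.v *)
Require Import Defs.
From mathcomp Require Import boolp ring lra.

Set Implicit Arguments.
Unset Strict Implicit.
Unset Printing Implicit Defensive.

Import Order.TTheory GRing.Theory Num.Theory.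
Local Open Scope classical_set_scope.
Local Open Scope ring_scope.

(** A point of QPB_3 is a matrix of first and second moments of a finitely
    supported probability measure on the box, and [z] can be taken to be the
    moment of [x1 x2 x3] for the same measure.  Every constraint is then an
    inequality between expectations.

    Replacing each coordinate [x p], [p \in S], by [1 - x p] maps the box to
    itself, and the substitution made by [switch S] is precisely its effect on
    the moments ([moments_switch]).  So only the unswitched constraints need a
    proof, for an arbitrary triple of moments:
    - [0 <= z] holds pointwise, and its eight switchings are exactly the eight
      linear constraints;
    - the cone constraints follow from the Cauchy-Schwarz inequality
      [E(fg)^2 <= E(f^2) E(g^2)] with [f = xi] and [g = xj xk], respectively
      [g = xj + xj xk], because on the box [g^2] is at most [xj xk],
      respectively [xj^2 + 3 xj xk] ([rsoc_mean]). *)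

Section Mean.
Variables (R : realType) (n : nat) (c : 'I_n -> R).

Definition mean (f : 'I_n -> R) : R := \sum_i c i * f i.

Lemma eq_mean f g : f =1 g -> mean f = mean g.
Proof. by move=> fg; apply: eq_bigr => i _; rewrite fg. Qed.

Lemma meanD f g : mean (fun i => f i + g i) = mean f + mean g.
Proof. by rewrite -big_split; apply: eq_bigr => i _; rewrite mulrDr. Qed.

Lemma meanB f g : mean (fun i => f i - g i) = mean f - mean g.
Proof. by rewrite -sumrB; apply: eq_bigr => i _; rewrite mulrBr. Qed.

Lemma meanZ a f : mean (fun i => a * f i) = a * mean f.
Proof. by rewrite mulr_sumr; apply: eq_bigr => i _; rewrite mulrCA. Qed.

Lemma mean1D f : \sum_i c i = 1 -> mean (fun i => f i + 1) = mean f + 1.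
Proof.
move=> c1; rewrite meanD; congr (_ + _).
by rewrite -[RHS]c1; apply: eq_bigr => i _; rewrite mulr1.
Qed.

Lemma mean1B f : \sum_i c i = 1 -> mean (fun i => 1 - f i) = 1 - mean f.
Proof.
move=> c1; rewrite meanB; congr (_ - _).
by rewrite -[RHS]c1; apply: eq_bigr => i _; rewrite mulr1.
Qed.

Hypothesis c_ge0 : forall i, 0 <= c i.

Lemma mean_ge0 f : (forall i, 0 <= f i) -> 0 <= mean f.
Proof. by move=> f0; apply: sumr_ge0 => i _; rewrite mulr_ge0. Qed.

Lemma le_mean f g : (forall i, f i <= g i) -> mean f <= mean g.
Proof. by move=> fg; apply: ler_sum => i _; rewrite ler_wpM2l. Qed.

(** Lagrange's identity writes twice the defect as the double sum of the
    nonnegative terms [c i * c j * (f i * g j - f j * g i) ^+ 2]. *)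
Lemma mean_Cauchy_Schwarz f g :
  mean (fun i => f i * g i) ^+ 2 <=
    mean (fun i => f i ^+ 2) * mean (fun i => g i ^+ 2).
Proof.
set B := mean (fun i => f i * g i).
set A := mean (fun i => f i ^+ 2); set D := mean (fun i => g i ^+ 2).
have : 0 <= \sum_i \sum_j c i * c j * (f i * g j - f j * g i) ^+ 2.
  apply: sumr_ge0 => i _; apply: sumr_ge0 => j _.
  by rewrite mulr_ge0 ?sqr_ge0 ?mulr_ge0.
have -> : \sum_i \sum_j c i * c j * (f i * g j - f j * g i) ^+ 2
    = A * D + D * A - 2 * (B * B).
  rewrite /A /B /D /mean !big_distrlr /= mulr_sumr -big_split -sumrB /=.
  apply: eq_bigr => i _; rewrite mulr_sumr -big_split -sumrB /=.
  by apply: eq_bigr => j _; ring.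
by rewrite expr2; lra.
Qed.

(** The form in which Cauchy-Schwarz gives the cone constraints: the factor
    [g ^+ 2] may be relaxed to any pointwise upper bound [h]. *)
Lemma rsoc_mean f g h : (forall i, g i ^+ 2 <= h i) ->
  rsoc (mean (fun i => f i * g i)) (mean (fun i => f i * f i)) (mean h).
Proof.
move=> gh; have ff : 0 <= mean (fun i => f i * f i).
  by apply: mean_ge0 => i; rewrite -expr2 sqr_ge0.
split=> //; last first.
  by apply: mean_ge0 => i; apply: le_trans (gh i); rewrite sqr_ge0.
by apply: le_trans (mean_Cauchy_Schwarz f g) _; rewrite ler_wpM2l ?le_mean.
Qed.

End Mean.

Lemma prod_ord3 (R : realType) (f : 'I_3 -> R) :
  \prod_p f p = f i1 * f i2 * f i3.
Proof.
rewrite !big_ord_recl big_ord0 mulr1 mulrA.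
by congr (_ * _ * _); congr f; apply: val_inj.
Qed.

(** The product is written over all indices, rather than as [y1 * y2 * y3], so
    that it is visibly invariant under permutations of the coordinates. *)
Definition moments (R : realType) : constraint R := fun x X z =>
  exists (n : nat) (c : 'I_n -> R) (y : 'I_n -> 'cV[R]_3),
  [/\ forall i, 0 <= c i, \sum_i c i = 1 & forall i, Box3 (y i)] /\
  [/\ forall p, x p 0 = mean c (fun i => y i p 0),
      forall p q, X p q = mean c (fun i => y i p 0 * y i q 0)
    & z = mean c (fun i => \prod_p y i p 0)].

Lemma hom_row_Gram (R : realType) (y : 'cV[R]_3) :
  (hom_row y)^T *m hom_row y = Ymx y (y *m y^T).
Proof.
by rewrite /hom_row tr_row_mx trmxK trmx1 mul_col_row mul1mx mul1mx mulmx1.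
Qed.

Lemma QPB3_moments (R : realType) (x : 'cV[R]_3) (X : 'M[R]_3) :
  @QPB3 R (Ymx x X) -> exists z, moments x X z.
Proof.
move=> [n [c [a [c_ge0 c1 aA YE]]]].
have /choice[y ya] i :
    exists y, Box3 y /\ a i = Ymx y (y *m y^T).
  by have [y yB <-] := aA i; exists y; rewrite hom_row_Gram.
have aE i : a i = Ymx (y i) (y i *m (y i)^T) by have [] := ya i.
exists (mean c (fun i => \prod_p y i p 0)), n, c, y.
split; split=> //; first by move=> i; have [] := ya i.
- move=> p; have := congr1 (fun M : 'M_(1 + 3) => M (rshift 1 p) (lshift 3 0)) YE.
  rewrite block_mxEdl summxE => ->; apply: eq_bigr => i _.
  by rewrite mxE aE block_mxEdl.
- move=> p q.
  have := congr1 (fun M : 'M_(1 + 3) => M (rshift 1 p) (rshift 1 q)) YE.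
  rewrite block_mxEdr summxE => ->; apply: eq_bigr => i _.
  by rewrite mxE aE block_mxEdr mxE big_ord1 mxE.
Qed.

Lemma Box3_switch (R : realType) (S : {set 'I_3}) (y : 'cV[R]_3) :
  Box3 y -> Box3 (switch_x S y).
Proof.
move=> yB p; rewrite mxE; have /andP[y0 y1] := yB p.
by case: ifP => _; apply/andP; split; lra.
Qed.

(** Reflecting the support of the measure in the coordinates of [S] realizes
    the switched moments; each case is linearity of the mean. *)
Lemma moments_switch (R : realType) (S : {set 'I_3}) (x : 'cV[R]_3)
    (X : 'M[R]_3) (z : R) :
  moments x X z -> switch S (@moments R) x X z.
Proof.
move=> [n [c [y [[c_ge0 c1 yB] [xE XE zE]]]]].
exists n, c, (fun i => switch_x S (y i)); split; first split=> //.
  by move=> i; apply: Box3_switch.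
split.
- move=> p; rewrite mxE xE; case pS: (p \in S); rewrite -?mean1B //;
    by apply: eq_mean => i; rewrite mxE pS.
- move=> p q; rewrite mxE !XE !xE; case: eqP => [<-|_].
    case pS: (p \in S); rewrite -?meanZ -?mean1B // -?meanD;
      by apply: eq_mean => i; rewrite mxE pS; ring.
  case pS: (p \in S); case qS: (q \in S); rewrite -?mean1D // -?meanB;
    by apply: eq_mean => i; rewrite !mxE pS qS; ring.
- rewrite /switch_z zE !XE !xE.
  case S1: (i1 \in S); case S2: (i2 \in S); case S3: (i3 \in S);
    rewrite -?mean1B // -?(meanB, meanD);
    by apply: eq_mean => i; rewrite !prod_ord3 !mxE S1 S2 S3; ring.
Qed.

Lemma moments_z_ge0 (R : realType) (x : 'cV[R]_3) (X : 'M[R]_3) (z : R) :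
  moments x X z -> 0 <= z.
Proof.
move=> [n [c [y [[c_ge0 _ yB] [_ _ ->]]]]]; apply: mean_ge0 => // i.
by apply: prodr_ge0 => p _; have /andP[] := yB i p.
Qed.

Lemma moments_linear (R : realType) (x : 'cV[R]_3) (X : 'M[R]_3) (z : R) :
  moments x X z -> linear_constraints x X z.
Proof.
move=> m; have z_ge0 S := moments_z_ge0 (moments_switch S m).
move: (z_ge0 finset.set0) (z_ge0 [set i1]%SET) (z_ge0 [set i2]%SET)
  (z_ge0 [set i3]%SET) (z_ge0 [set i2; i3]%SET) (z_ge0 [set i1; i3]%SET)
  (z_ge0 [set i1; i2]%SET) (z_ge0 [set: 'I_3]%SET).
rewrite /switch_z !inE /= => *.
by split; [split|..]; lra.
Qed.

Section Cones.
Variables (R : realType) (i j k : 'I_3).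
Hypothesis prod_ijk : forall y : 'I_3 -> R, \prod_p y p = y i * (y j * y k).

Lemma moments_soc_z (x : 'cV[R]_3) (X : 'M[R]_3) (z : R) :
  moments x X z -> soc_z i j k x X z.
Proof.
move=> [n [c [y [[c_ge0 _ yB] [_ XE ->]]]]]; rewrite /soc_z !XE.
under eq_mean do rewrite prod_ijk.
apply: rsoc_mean => // l.
have /andP[? ?] := yB l j; have /andP[? ?] := yB l k.
by rewrite expr2 ler_piMl ?mulr_ge0 ?mulr_ile1.
Qed.

(** With [a = xj] and [b = xk] in the unit interval,
    [(a + a b)^2 = a^2 + 2 a^2 b + (a b)^2 <= a^2 + 3 a b]. *)
Lemma moments_soc_Xz (x : 'cV[R]_3) (X : 'M[R]_3) (z : R) :
  moments x X z -> soc_Xz i j k x X z.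
Proof.
move=> [n [c [y [[c_ge0 _ yB] [_ XE ->]]]]].
rewrite /soc_Xz !XE -meanZ -!meanD.
under eq_mean do rewrite prod_ijk -mulrDr.
apply: rsoc_mean => // l.
have /andP[a0 a1] := yB l j; have /andP[b0 b1] := yB l k.
set a := y l j 0 in a0 a1 *; set b := y l k 0 in b0 b1 *.
have ab0 : 0 <= a * b by rewrite mulr_ge0.
have aab : a * (a * b) <= a * b by rewrite ler_piMl.
have abab : (a * b) * (a * b) <= a * b by rewrite ler_piMl ?mulr_ile1.
have -> : (a + a * b) ^+ 2 = a * a + 2 * (a * (a * b)) + a * b * (a * b).
  by ring.
by lra.
Qed.

End Cones.

Theorem mainTheorem2 (R : realType) (x : 'cV[R]_3) (X : 'M[R]_3)
    (symX : X^T = X) (xX_QPB : @QPB3 R (Ymx x X)) :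
  exists z : R,
    [/\ linear_constraints x X z,
        forall S : {set 'I_3},
          [/\ switch S (@soc_z R i1 i2 i3) x X z,
              switch S (@soc_z R i2 i1 i3) x X z
            & switch S (@soc_z R i3 i1 i2) x X z]
      & forall (s : {perm 'I_3}) (S : {set 'I_3}),
          switch S (@soc_Xz R (s i1) (s i2) (s i3)) x X z].
Proof.
have [z m] := QPB3_moments xX_QPB; exists z.
split=> [|S|s S]; first exact: moments_linear.
  have mS := moments_switch S m.
  by split; apply: moments_soc_z mS => y; rewrite prod_ord3; ring.
apply: moments_soc_Xz (moments_switch S m) => y.
by rewrite (reindex_inj (@perm_inj _ s)) prod_ord3 mulrA.
Qed.
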